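(* Let $0<\gamma<\frac{\pi}{2}$, let $m\ge 1$ be an integer, and let $(R\sin\psi,R\cos\psi)$, with $R>0$ and $\frac{\pi}{2}-\gamma<\psi<\frac{\pi}{2}$, be a point of the wedge of opening angle $\gamma$. (i) There exists a closed $2m$-bounce path starting at the point if and only if $\gamma<\frac{\pi}{2m}$. There exist at most two such closed paths (the same path traversed in opposite directions), and the total length of a closed $2m$-bounce path starting at the point $(R\sin\psi,R\cos\psi)$ is $2R|\sin(m\gamma)|$. (ii) There exists a closed $(2m+1)$-bounce path starting at the point $(R\sin\psi,R\cos\psi)$ if and only if $\gamma<\frac{\pi}{2m}$ and at least one of the following two inequalities holds: (A) $\psi<\pi-(m+1)\gamma$; (B) $\psi>m\gamma$. There exist exactly none, one or two closed $(2m+1)$-bounce paths from the given point, according to these inequalities (one path for each of (A), (B) that holds). The total length of the closed $(2m+1)$-bounce path is $2R|\cos[\psi+(m+1)\gamma]|$ in case (A), and $2R|\cos(\psi-m\gamma)|$ in case (B).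
   Context: The wedge of opening angle $\gamma$ is the planar region $\{(R\sin\psi,R\cos\psi): R>0,\ \frac{\pi}{2}-\gamma\le\psi\le\frac{\pi}{2}\}$, with polar coordinates $(R,\psi)$, where $R$ is the distance from the vertex (the origin) and $\psi$ is measured from the vertical axis. It is bounded by the horizontal ray ($\psi=\frac{\pi}{2}$) and the inclined ray ($\psi=\frac{\pi}{2}-\gamma$); it is the cross-section of the region between two planes meeting along a line. A closed $n$-bounce path starting at a point $p$ of the wedge is a piecewise straight path inside the wedge which starts at $p$, undergoes exactly $n$ successive specular reflections off the two bounding rays (not at the vertex), and then ends at $p$; no reflection condition is imposed at $p$. Paths are considered as oriented (traversed) paths. *)

(* Defs.v *)
From HB Require Import structures.
From mathcomp Require Import all_boot all_order all_algebra.
From mathcomp Require Import all_classical all_reals all_analysis.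
Set Implicit Arguments.
Unset Strict Implicit.
Unset Printing Implicit Defensive.
Import Order.TTheory GRing.Theory Num.Theory.
Local Open Scope classical_set_scope.
Local Open Scope ring_scope.

Section WedgePaths.
Context {R : realType}.

(* The angle is measured from the vertical axis. *)
Definition polar (r psi : R) : R * R := (r * sin psi, r * cos psi).

Definition wedge (gamma : R) : set (R * R) :=
  [set x | exists r psi : R,
     [/\ 0 < r, pi / 2 - gamma <= psi <= pi / 2 & x = polar r psi]].

Definition ray (phi : R) : set (R * R) :=
  [set x | exists2 r : R, 0 < r & x = polar r phi].

Definition dot (u v : R * R) : R := u.1 * v.1 + u.2 * v.2.

(* Euclidean distance: the library norm on R * R is the sup norm. *)
Definition dist (a b : R * R) : R :=
  Num.sqrt ((b.1 - a.1) ^+ 2 + (b.2 - a.2) ^+ 2).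

Definition segment (a b : R * R) : set (R * R) :=
  [set x | exists2 t : R, 0 <= t <= 1 &
     x = (a.1 + t * (b.1 - a.1), a.2 + t * (b.2 - a.2))].

Definition direction (a b : R * R) : R * R :=
  ((b.1 - a.1) / dist a b, (b.2 - a.2) / dist a b).

(* The path a -> x -> b is specularly reflected at x off the ray of angle phi:
   the component of the unit velocity along the ray is kept, the component
   normal to it is reversed. The normal component is nonzero, since a path
   running along the ray is not reflected by it. *)
Definition reflected_off (phi : R) (a x b : R * R) : Prop :=
  let tangent := polar 1 phi in
  let normal := (cos phi, - sin phi) in
  [/\ ray phi x,
      dot (direction x b) tangent = dot (direction a x) tangent,
      dot (direction x b) normal = - dot (direction a x) normal
    & dot (direction a x) normal != 0].

Definition bounce (gamma : R) (a x b : R * R) : Prop :=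
  reflected_off (pi / 2) a x b \/ reflected_off (pi / 2 - gamma) a x b.

(* An oriented closed n-bounce path from p is encoded by the tuple q of its
   successive reflection points; vertex p q i, for 0 <= i <= n + 1, runs
   through p, q_1, ..., q_n, p. *)
Definition vertex (p : R * R) (n : nat) (q : n.-tuple (R * R)) (i : nat) :
  R * R := nth p (p :: rcons q p) i.

Definition closed_bounce_path (gamma : R) (p : R * R) (n : nat)
    (q : n.-tuple (R * R)) : Prop :=
  [/\ forall i : nat, (i < n.+1)%N -> vertex p q i != vertex p q i.+1,
      forall i : nat, (i < n.+1)%N ->
        segment (vertex p q i) (vertex p q i.+1) `<=` wedge gamma
    & forall i : nat, (i < n)%N ->
        bounce gamma (vertex p q i) (vertex p q i.+1) (vertex p q i.+2)].

Definition path_length (p : R * R) (n : nat) (q : n.-tuple (R * R)) : R :=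
  \sum_(i < n.+1) dist (vertex p q i) (vertex p q i.+1).

End WedgePaths.

(* Main.v *)
Require Import Defs.
From HB Require Import structures.
From mathcomp Require Import all_boot all_order all_algebra.
From mathcomp Require Import all_classical all_reals all_analysis.
From mathcomp Require Import ring lra zify.
Set Implicit Arguments.
Unset Strict Implicit.
Unset Printing Implicit Defensive.
Import Order.TTheory GRing.Theory Num.Theory.
Local Open Scope classical_set_scope.
Local Open Scope card_scope.
Local Open Scope ring_scope.

(** Instead of reflecting the path at a wall of the wedge, reflect the wedge.
    A path with [n] bounces then unfolds into a straight segment which crosses
    successive images of the walls, at angles [gamma] apart around the vertex,
    and ends at an image of the base point at the same distance [r] from the
    vertex. Conversely, such a segment folds back to a closed path. The two
    possible paths correspond to the wall of the first bounce, since a path that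
    leaves a wall with a nonzero normal velocity must hit the other one next.

    A segment that misses the vertex is seen from it under an angle less than
    [pi]; conversely, as long as the total angle [swept_angle] swept by the
    unfolded path is less than [pi], the chord between the base point and its
    last image crosses all the images of the walls in order. Hence there is
    exactly one path per first wall with swept angle below [pi]
    ([closed_bounce_pathP]), namely the chord of the circle of radius [r]
    subtended by that angle, of length [2 * r * sin (swept_angle / 2)]
    ([path_length_bounce_points]).

    For [2 * m] bounces the swept angle is [2 * m * gamma] for both first walls,
    and the two paths are the reversals of each other ([rev_bounce_points]). For
    [2 * m + 1] bounces it is twice the sum of [m * gamma] and the angle from
    the base point to the first wall, and being below [pi] is condition (A) when
    the first bounce is off the inclined wall and condition (B) when it is off
    the horizontal one. Each implies [gamma < pi / (2 * m)].

    Unfolding is carried out in polar coordinates around the vertex. With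
    [u = 1 / rho], the equation of a line is that [u] is a sinusoid in the
    angle, so that the law of reflection becomes a linear relation between three
    consecutive values of [u] ([reflected_off_polar], [bounce_relation]), in
    which only the unfolded angles appear. Such relations force the whole
    sequence to lie on one sinusoid, which the two endpoints determine
    ([discrete_sinusoid_chord]). *)

(** * Sinusoids and polar equations of lines *)

Section Trigonometry.
Context {R : realType}.
Implicit Types x y z t a : R.

(** A line that misses the origin has the polar equation
    1 / rho = c * cos a + s * sin a, so this is the collinearity condition for
    three points given in polar coordinates. *)
Lemma sinusoid_three_points (c s : R) x y z :
  let u := fun a => c * cos a + s * sin a in
  u y * sin (z - x) = u x * sin (z - y) + u z * sin (y - x).
Proof.
rewrite /= !sinB; ring.
Qed.

Lemma sinD_half_sum x y z :
  let h := (z - x) / 2 in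
  sin (z - y) + sin (y - x) = 2 * sin h * cos (y - x - h).
Proof.
move=> h; set k := y - x - h.
have -> : z - y = h - k by rewrite /k /h; field.
have -> : y - x = h + k by rewrite /k /h; field.
move: h k => h k; by rewrite sinB sinD; ring.
Qed.

End Trigonometry.

(** * Specular reflection in polar coordinates *)

Section PlaneGeometry.
Context {R : realType}.
Implicit Types (a b x y v : R * R) (e rho phi s t : R).

Definition normal phi : R * R := (cos phi, - sin phi).

Lemma dist_ge0 a b : 0 <= dist a b. Proof. exact: sqrtr_ge0. Qed.

(** The axes along and across a ray are orthonormal, so the distance can be
    computed in the frame in which the law of reflection is expressed. *)
Lemma dist_sqr phi a b :
  dist a b ^+ 2 = (dot b (polar 1 phi) - dot a (polar 1 phi)) ^+ 2
                + (dot b (normal phi) - dot a (normal phi)) ^+ 2.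
Proof.
rewrite /dist sqr_sqrtr ?addr_ge0 ?sqr_ge0 // /dot /polar /normal /=.
have h := cos2Dsin2 phi.
transitivity (((b.1 - a.1) ^+ 2 + (b.2 - a.2) ^+ 2)
              * (cos phi ^+ 2 + sin phi ^+ 2)); first by rewrite h mulr1.
ring.
Qed.

Lemma direction_dot a b v :
  dot (direction a b) v = (dot b v - dot a v) / dist a b.
Proof. by rewrite /dot /direction /=; ring. Qed.

Lemma polar_dot_tangent rho s phi :
  dot (polar rho s) (polar 1 phi) = rho * cos (s - phi).
Proof. by rewrite /dot /polar /= cosB; ring. Qed.

Lemma polar_dot_normal rho s phi :
  dot (polar rho s) (normal phi) = rho * sin (s - phi).
Proof. by rewrite /dot /polar /= sinB; ring. Qed.

Lemma polar_norm rho phi : 0 <= rho ->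
  Num.sqrt ((polar rho phi).1 ^+ 2 + (polar rho phi).2 ^+ 2) = rho.
Proof.
move=> rho0; have h := cos2Dsin2 phi.
rewrite /polar /= (_ : _ + _ = rho ^+ 2 * (cos phi ^+ 2 + sin phi ^+ 2));
  last by ring.
by rewrite h mulr1 sqrtr_sqr ger0_norm.
Qed.

Lemma dist_polar rho rho' s t :
  dist (polar rho s) (polar rho' t) ^+ 2 =
  rho ^+ 2 + rho' ^+ 2 - 2 * rho * rho' * cos (s - t).
Proof.
rewrite (dist_sqr s) !polar_dot_tangent !polar_dot_normal subrr cos0 sin0.
have h := cos2Dsin2 (t - s).
rewrite (_ : s - t = - (t - s)) ?cosN; last ring.
transitivity (rho ^+ 2 - 2 * rho * rho' * cos (t - s)
  + rho' ^+ 2 * (cos (t - s) ^+ 2 + sin (t - s) ^+ 2)); first by ring.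
by rewrite h; ring.
Qed.

Lemma polar_neq rho rho' s t :
  0 < rho -> 0 < rho' -> sin (s - t) != 0 -> polar rho s != polar rho' t.
Proof.
move=> r0 r0' st; apply/eqP => E.
have := polar_dot_normal rho s t; rewrite E polar_dot_normal subrr sin0 mulr0.
by move/esym/eqP; rewrite mulf_eq0 (negPf st) gt_eqF.
Qed.

(** Two vectors on the same side of a line have the same direction as soon as
    their slopes agree; [d] and [d'] are their lengths. *)
Lemma unit_directions_eq (p q p' q' d d' : R) :
  0 < q -> 0 < q' -> 0 <= d -> 0 <= d' ->
  d ^+ 2 = p ^+ 2 + q ^+ 2 -> d' ^+ 2 = p' ^+ 2 + q' ^+ 2 ->
  (p' / d' = p / d /\ q' / d' = q / d) <-> p' * q = p * q'.
Proof.
move=> q0 q0' d0 d0' dE dE'.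
have {}d0 : 0 < d.
  by rewrite lt_def d0 andbT -sqrf_eq0 dE gt_eqF // ltr_wpDl ?sqr_ge0 ?exprn_gt0.
have {}d0' : 0 < d'.
  by rewrite lt_def d0' andbT -sqrf_eq0 dE' gt_eqF // ltr_wpDl ?sqr_ge0 ?exprn_gt0.
have nd : d != 0 by rewrite gt_eqF.
have nd' : d' != 0 by rewrite gt_eqF.
have nq : q != 0 by rewrite gt_eqF.
split.
  case=> /eqP; rewrite eqr_div // => /eqP E1 /eqP; rewrite eqr_div // => /eqP E2.
  apply: (mulIf nd); apply: (mulIf nd').
  transitivity ((p' * d) * (q * d')); first ring.
  by rewrite E1 -E2; ring.
move=> E.
have dd : d' * q = q' * d.
  apply/eqP; rewrite -(@eqrXn2 _ 2) ?mulr_ge0 ?ltW //; apply/eqP.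
  rewrite !exprMn dE dE' !mulrDl mulrDr -!exprMn E; ring.
split; apply/eqP; rewrite eqr_div //; apply/eqP; last by rewrite -dd mulrC.
apply: (mulIf nq).
transitivity ((p' * q) * d); first ring.
by rewrite E -!mulrA dd.
Qed.

(** Reflecting the outgoing half-path in the ray turns the law of reflection
    into collinearity: the mirror image of the endpoint lies at angle [t] on
    the other side of the ray, and the three points at angles [-s], [0], [t]
    must satisfy the polar equation of one line. The sign [e] says on which
    side of the ray the wedge lies. *)
Lemma reflected_off_polar e phi (ra rx rb : R) s t :
  e = 1 \/ e = -1 -> 0 < ra -> 0 < rx -> 0 < rb -> 0 < sin s -> 0 < sin t ->
  reflected_off phi (polar ra (phi + e * s)) (polar rx phi)
                    (polar rb (phi + e * t)) <->
  rx^-1 * sin (s + t) = ra^-1 * sin t + rb^-1 * sin s.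
Proof.
move=> he ra0 rx0 rb0 s0 t0.
have sinE z : sin (e * z) = e * sin z.
  by case: he => ->; rewrite ?mul1r // !mulN1r sinN.
have cosE z : cos (e * z) = cos z.
  by case: he => ->; rewrite ?mul1r // mulN1r cosN.
have e0 : e != 0 by case: he => ->; rewrite ?oppr_eq0 oner_eq0.
have ee z : z ^+ 2 = (e * z) ^+ 2 by case: he => ->; ring.
have shift z : phi + z - phi = z by ring.
rewrite /reflected_off -/(normal phi) !direction_dot.
set A := polar ra _; set X := polar rx _; set B := polar rb _.
have dA : dist A X ^+ 2 = (rx - ra * cos s) ^+ 2 + (ra * sin s) ^+ 2.
  rewrite (dist_sqr phi) !polar_dot_tangent !polar_dot_normal subrr shift.
  rewrite cos0 sin0 sinE cosE [(ra * sin s) ^+ 2]ee; ring.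
have dB : dist X B ^+ 2 = (rb * cos t - rx) ^+ 2 + (rb * sin t) ^+ 2.
  rewrite (dist_sqr phi) !polar_dot_tangent !polar_dot_normal subrr shift.
  rewrite cos0 sin0 sinE cosE [(rb * sin t) ^+ 2]ee; ring.
rewrite !polar_dot_tangent !polar_dot_normal subrr !shift cos0 sin0 !sinE !cosE.
rewrite !mulr1 !mulr0 subr0 sub0r mulNr opprK.
have qa : 0 < ra * sin s by rewrite mulr_gt0.
have qb : 0 < rb * sin t by rewrite mulr_gt0.
have key := unit_directions_eq qa qb (dist_ge0 _ _) (dist_ge0 _ _) dA dB.
have nA : dist A X != 0.
  by rewrite -sqrf_eq0 dA gt_eqF // ltr_wpDl ?sqr_ge0 ?exprn_gt0.
have alg : (rb * cos t - rx) * (ra * sin s) = (rx - ra * cos s) * (rb * sin t)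
   <-> rx^-1 * sin (s + t) = ra^-1 * sin t + rb^-1 * sin s.
  have [na nx nb] : [/\ ra != 0, rx != 0 & rb != 0] by rewrite !gt_eqF.
  rewrite sinD; split=> E.
    apply: (mulIf nx); apply: (mulIf na); apply: (mulIf nb).
    transitivity (ra * rb * (sin s * cos t + cos s * sin t)); first by field.
    transitivity (rx * (ra * sin s + rb * sin t)); last by field; rewrite na nb.
    by lra.
  have : ra * rb * (sin s * cos t + cos s * sin t)
          = rx * (ra * sin s + rb * sin t).
    transitivity (ra * rb * rx * (rx^-1 * (sin s * cos t + cos s * sin t))).
      by field; rewrite ?nx.
    by rewrite E; field; rewrite na nb.
  by lra.
rewrite -alg -key; split.
  case=> _ E1 E2 _; split=> //; apply: (mulfI e0).
  by rewrite !mulrA -(mulrC rb) -(mulrC ra) -!(mulrA _ e).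
case=> E1 E2; split=> //.
- by exists rx.
- by rewrite !(mulrCA _ e) -!(mulrA e) E2.
- by rewrite oppr_eq0 mulrCA -mulrA !mulf_neq0 ?invr_eq0 // gt_eqF.
Qed.

(** The outgoing direction has a nonzero normal component, so the path leaves
    the ray. This forces successive bounces to alternate between the walls. *)
Lemma reflected_off_notin phi a x b :
  reflected_off phi a x b -> ~ ray phi b.
Proof.
case=> [[rho _ ->]]; rewrite -/(normal phi) !direction_dot => _ + nz [rho' _ Eb].
rewrite Eb !polar_dot_normal !subrr sin0 !mulr0 subrr mul0r => /esym/eqP.
by rewrite oppr_eq0; apply/negP; move: nz; rewrite polar_dot_normal subrr sin0 mulr0.
Qed.

End PlaneGeometry.

(** * Convexity of the wedge *)

Section Wedge.
Context {R : realType}.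
Variable gamma : R.
Hypothesis gamma_acute : 0 < gamma < pi / 2.

(** The wedge is an intersection of half-planes, one of them open because the
    vertex is excluded; convexity is then immediate. *)
Lemma wedgeP (x : R * R) :
  wedge gamma x <->
  [/\ 0 < x.1, 0 <= x.2 & cos gamma * x.2 <= sin gamma * x.1].
Proof.
have pi0 := @pi_gt0 R; have /andP[g0 g2] := gamma_acute.
split.
  case=> r [psi [r0 /andP[l u] ->]]; rewrite /polar /=; split.
  - by rewrite mulr_gt0 // sin_gt0_pi //; apply/andP; split; lra.
  - by apply: mulr_ge0; [exact: ltW | apply: cos_ge0_pihalf; apply/andP; split; lra].
  - rewrite !(mulrCA _ r) ler_pM2l //.
    have : 0 <= sin (gamma + psi - pi / 2).
      by apply: sin_ge0_pi; apply/andP; split; lra.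
    by rewrite sinBpihalf cosD; lra.
case: x => a b /= [a0 b0 ab].
have s0 : 0 < a ^+ 2 + b ^+ 2 by rewrite ltr_pwDl ?exprn_gt0 ?sqr_ge0.
pose rho := Num.sqrt (a ^+ 2 + b ^+ 2).
have rho0 : 0 < rho by rewrite sqrtr_gt0.
have rho2 : rho ^+ 2 = a ^+ 2 + b ^+ 2 by rewrite sqr_sqrtr // ltW.
have nrho : rho != 0 by rewrite gt_eqF.
have brho : b / rho <= 1.
  by rewrite ler_pdivrMr // mul1r -ler_sqr ?nnegrE ?(ltW rho0) // rho2 lerDr sqr_ge0.
have b1 : -1 <= b / rho <= 1.
  by rewrite brho andbT (le_trans (lerN10 _)) // divr_ge0 // ltW.
pose psi := acos (b / rho).
have cpsi : cos psi = b / rho by rewrite acosK // in_itv.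
have spsi : sin psi = a / rho.
  rewrite sin_acos // -[RHS]ger0_norm ?divr_ge0 ?ltW // -sqrtr_sqr; congr Num.sqrt.
  by rewrite !exprMn exprVn rho2; field; rewrite gt_eqF.
have psi0 : 0 <= psi by rewrite acos_ge0.
have psipi : psi <= pi by rewrite acos_lepi.
exists rho, psi; split=> //; last first.
  by rewrite /polar cpsi spsi !(mulrC rho) !divfK.
apply/andP; split; rewrite leNgt; apply/negP => lt.
- have : 0 < cos (gamma + psi).
    by rewrite cos_gt0_pihalf //; apply/andP; split; lra.
  rewrite cosD cpsi spsi !mulrA -mulrBl pmulr_lgt0 ?invr_gt0 // subr_gt0.
  by rewrite ltNge ab.
- have : 0 < cos (pi - psi).
    by rewrite cos_gt0_pihalf //; apply/andP; split; lra.
  rewrite cosB cospi sinpi mul0r addr0 mulN1r cpsi oppr_gt0 ltNge.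
  by rewrite divr_ge0 // ltW.
Qed.

Lemma segment_wedge (a b : R * R) :
  wedge gamma a -> wedge gamma b -> segment a b `<=` wedge gamma.
Proof.
move=> /wedgeP[a1 a2 a3] /wedgeP[b1 b2 b3] _ [t /andP[t0 t1] ->].
have mix (x y : R) : x + t * (y - x) = (1 - t) * x + t * y by ring.
have t1' : 0 <= 1 - t by rewrite subr_ge0.
apply/wedgeP; rewrite /= !mix; split.
- have [->|tn0] := eqVneq t 0; first by rewrite subr0 mul1r mul0r addr0.
  by rewrite ltr_wpDl ?mulr_ge0 ?(ltW a1) // mulr_gt0 // lt_def tn0.
- by rewrite addr_ge0 // mulr_ge0.
- rewrite !mulrDr !(mulrCA _ (1 - t)) !(mulrCA _ t).
  by rewrite lerD // ler_wpM2l.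
Qed.

End Wedge.

(** * Sequences of collinear points in polar form *)

Section DiscreteSinusoid.
Context {R : realType}.
Implicit Types (u al : nat -> R).

(** If each three consecutive points are collinear then all are: the line
    through the first two points determines the others one by one. *)
Lemma discrete_sinusoid n u al :
  (forall i, (i <= n)%N -> 0 < sin (al i.+1 - al i)) ->
  (forall i, (i < n)%N -> u i.+1 * sin (al i.+2 - al i) =
     u i * sin (al i.+2 - al i.+1) + u i.+2 * sin (al i.+1 - al i)) ->
  exists c s, forall k, (k <= n.+1)%N -> u k = c * cos (al k) + s * sin (al k).
Proof.
move=> al0 rel.
have nz : sin (al 1) * cos (al 0) - cos (al 1) * sin (al 0) != 0.
  by rewrite -sinB gt_eqF // al0.
pose d := sin (al 1) * cos (al 0) - cos (al 1) * sin (al 0).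
pose c := (u 0%N * sin (al 1) - u 1%N * sin (al 0)) / d.
pose s := (u 1%N * cos (al 0) - u 0%N * cos (al 1)) / d.
exists c, s.
suff P k : (k <= n)%N -> u k = c * cos (al k) + s * sin (al k) /\
                         u k.+1 = c * cos (al k.+1) + s * sin (al k.+1).
  move=> [_|k]; first by case: (P 0%N).
  by rewrite ltnS => /P[].
elim: k => [_|k IH lk].
  by rewrite /c /s /d; split; field.
have [uk uk1] := IH (ltnW lk); split=> //.
have nzk : sin (al k.+1 - al k) != 0 by rewrite gt_eqF // al0 // ltnW.
apply: (mulIf nzk).
have := rel k lk; have /= := sinusoid_three_points c s (al k) (al k.+1) (al k.+2).
by rewrite -uk -uk1 => -> /addrI.
Qed.

(** A straight line that misses the origin is seen from it under an angle less
    than [pi]. If the sweep first reached [pi] in passing from step [k.+1] to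
    step [k.+2], the collinearity relation between the points [0], [k.+1],
    [k.+2] would equate a nonpositive number with a sum of positive ones; steps
    shorter than [pi / 2] keep the overshoot within the range where the sine
    is nonpositive. Given this bound, the endpoints determine the line. *)
Lemma discrete_sinusoid_chord n u al :
  (forall i, (i <= n)%N -> 0 < al i.+1 - al i < pi / 2) ->
  (forall i, (i <= n.+1)%N -> 0 < u i) ->
  (forall i, (i < n)%N -> u i.+1 * sin (al i.+2 - al i) =
     u i * sin (al i.+2 - al i.+1) + u i.+2 * sin (al i.+1 - al i)) ->
  0 < al n.+1 - al 0%N < pi /\
  forall k, (k <= n.+1)%N -> u k * sin (al n.+1 - al 0%N) =
     u 0%N * sin (al n.+1 - al k) + u n.+1 * sin (al k - al 0%N).
Proof.
move=> step upos rel; have pi0 := @pi_gt0 R.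
have sin_step i : (i <= n)%N -> 0 < sin (al i.+1 - al i).
  by move=> /step /andP[a b]; rewrite sin_gt0_pi // a /=; lra.
have [c [s uE]] := discrete_sinusoid sin_step rel.
have three i j k : (i <= n.+1)%N -> (j <= n.+1)%N -> (k <= n.+1)%N ->
  u j * sin (al k - al i) = u i * sin (al k - al j) + u k * sin (al j - al i).
  by move=> *; rewrite !uE //; exact: sinusoid_three_points.
split; last by move=> k lk; apply: three.
have : (n < n.+1)%N by [].
elim: {-2}n => [_|k IH lk].
  by have /andP[a b] := step 0%N isT; rewrite a /=; lra.
have /andP[a b] := IH (ltnW lk); have /andP[a' b'] := step k.+1 lk.
apply/andP; split; first lra.
rewrite ltNge; apply/negP => le_pi.
have pos : 0 < sin (al k.+2 - al 0%N).
  rewrite -(pmulr_rgt0 _ (upos k.+1 _)) ?(ltnW lk) //.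
  by rewrite three ?ltnS // 1?ltnW // addr_gt0 // mulr_gt0 ?upos ?sin_step //
     ?sin_gt0_pi ?a ?b // ltnW.
have : 0 <= sin (al k.+2 - al 0%N - pi).
  by rewrite sin_ge0_pi //; apply/andP; split; lra.
by rewrite sinB cospi sinpi mulr0 subr0 mulrN1 oppr_ge0 leNgt pos.
Qed.

End DiscreteSinusoid.

(** * Unfolding the wedge *)

Section Unfolding.
Context {R : realType}.
Variables gamma psi r : R.
Hypothesis gamma_acute : 0 < gamma < pi / 2.
Hypothesis psi_inside : pi / 2 - gamma < psi < pi / 2.
Hypothesis r_gt0 : 0 < r.
Implicit Types (w : bool) (n i : nat).

(** [true] stands for the inclined wall. [side] is the sign of the angle from
    a wall to the interior of the wedge. *)
Definition wall w : R := if w then pi / 2 - gamma else pi / 2.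
Definition side w : R := if w then 1 else -1.
Definition offset w : R := side w * (psi - wall w).

(** The angle of the [i]-th vertex of a path with [n] bounces whose first bounce
    is off the wall [w]; vertices [0] and [n.+1] are the base point. *)
Definition path_angle n w i : R :=
  if i is j.+1 then if j == n then psi else wall (w (+) odd j) else psi.

(** The same vertex after unfolding, as an angle measured from the base point:
    successive images of the walls are [gamma] apart, and the last image of the
    base point lies beyond the image of the last wall by its offset from it. *)
Definition unfolded_angle n w i : R :=
  if i is j.+1 then
    offset w + (if j == n then n.-1%:R * gamma + offset (w (+) odd n.-1)
                else j%:R * gamma)
  else 0.

(** The angle under which the base point and its last image are seen from the
    vertex of the wedge. *)
Definition swept_angle n w : R := unfolded_angle n w n.+1.

Lemma bounceP a x b :
  bounce gamma a x b <-> exists w, reflected_off (wall w) a x b.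
Proof.
split; first by case=> ?; [exists false | exists true].
by case=> -[] ?; [right | left].
Qed.

Lemma offset_bounds w : 0 < offset w < gamma.
Proof.
have /andP[? ?] := psi_inside.
by case: w; rewrite /offset /side /wall; apply/andP; split; lra.
Qed.

Lemma unfolded_angle_step n w i : (0 < n)%N -> (i <= n)%N ->
  0 < unfolded_angle n w i.+1 - unfolded_angle n w i < pi / 2.
Proof.
move=> n0; have /andP[g0 g2] := gamma_acute.
have ob w' : 0 < offset w' < pi / 2.
  by have /andP[-> /lt_trans->] := offset_bounds w'.
case: i => [_|i lin] /=.
  by rewrite eq_sym gtn_eqF // mul0r addr0 subr0 ob.
rewrite (ltn_eqF lin); case: eqP => [ein|_].
  have -> : n.-1 = i by rewrite -ein.
  by rewrite opprD addrACA subrr add0r addrC addKr ob.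
by rewrite opprD addrACA subrr add0r -mulrBl -natrB // subSnn mul1r g0.
Qed.

(** Folding is an isometry on each step, with orientation reversed by each
    bounce. *)
Lemma path_angle_step n w i : (0 < n)%N -> (i <= n)%N ->
  path_angle n w i = path_angle n w i.+1
    + side (w (+) odd i) * (unfolded_angle n w i.+1 - unfolded_angle n w i).
Proof.
move=> n0; case: i => [_|i lin] /=.
  rewrite eq_sym gtn_eqF // mul0r addr0 subr0 /= addbF /offset.
  by case: w; rewrite /side; ring.
rewrite (ltn_eqF lin); case: eqP => [ein|_].
  rewrite -ein /= addbN; set b := w (+) odd i.
  by rewrite /offset; case: b; rewrite /= /side; ring.
rewrite addbN; set b := w (+) odd i.
by case: b; rewrite /= /side /wall -[i.+1]addn1 natrD; ring.
Qed.

(** The law of reflection at each bounce is the collinearity of three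
    consecutive unfolded vertices. *)
Lemma bounce_relation n w (rho : nat -> R) i : (i < n)%N ->
  (forall k, (k <= n.+1)%N -> 0 < rho k) ->
  let v k := polar (rho k) (path_angle n w k) in
  let al := unfolded_angle n w in
  reflected_off (wall (w (+) odd i)) (v i) (v i.+1) (v i.+2) <->
  (rho i.+1)^-1 * sin (al i.+2 - al i) =
    (rho i)^-1 * sin (al i.+2 - al i.+1) + (rho i.+2)^-1 * sin (al i.+1 - al i).
Proof.
move=> lin rho0 v al; have n0 : (0 < n)%N by apply: leq_ltn_trans lin.
have pi0 := @pi_gt0 R.
have sin_step k : (k <= n)%N -> 0 < sin (al k.+1 - al k).
  move=> lk; have /andP[? ?] := unfolded_angle_step w n0 lk.
  by rewrite sin_gt0_pi //; apply/andP; split; rewrite /al; lra.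
have e1 : path_angle n w i.+1 = wall (w (+) odd i) by rewrite /= (ltn_eqF lin).
have e0 := path_angle_step w n0 (ltnW lin); rewrite e1 in e0.
have e2 : path_angle n w i.+2 =
    wall (w (+) odd i) + side (w (+) odd i) * (al i.+2 - al i.+1).
  have := path_angle_step w n0 lin; rewrite e1 /= => ->.
  by rewrite addbN; case: (w (+) odd i); rewrite /side /al /=; ring.
rewrite /v e0 e1 e2.
rewrite reflected_off_polar ?sin_step ?rho0 //; first 1 last.
- by case: (w (+) odd i); [left | right].
- by rewrite ltnW // ltnW.
- by rewrite ltnW.
- by rewrite ltnW.
by rewrite -/al (_ : al i.+1 - al i + _ = al i.+2 - al i) //; ring.
Qed.

(** Polar equation of the chord joining two points at distance [r] from the
    origin: the foot of the perpendicular is at distance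
    [r * cos (swept_angle n w / 2)], in the direction of the bisector. *)
Definition radius n w i : R :=
  r * cos (swept_angle n w / 2) / cos (unfolded_angle n w i - swept_angle n w / 2).

Definition bounce_points n w : n.-tuple (R * R) :=
  [tuple polar (radius n w i.+1) (path_angle n w i.+1) | i < n].

(** The default value of [nth] stands for the final return to the base point, so
    this also covers the last vertex. *)
Lemma vertexE (p : R * R) n (q : n.-tuple (R * R)) i :
  vertex p q i.+1 = nth p q i.
Proof.
rewrite /vertex /= nth_rcons; case: ltnP => // le; rewrite if_same.
by rewrite nth_default.
Qed.

Lemma unfolded_angle_bounds n w i : (0 < n)%N -> (i <= n.+1)%N ->
  0 <= unfolded_angle n w i <= swept_angle n w.
Proof.
move=> n0.
have mono k l : (k <= l)%N -> (l <= n.+1)%N -> unfolded_angle n w k <= unfolded_angle n w l.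
  move=> kl; rewrite -(subnKC kl); elim: (l - k)%N => [|d IH]; first by rewrite addn0.
  rewrite addnS ltnS => ld; apply: (le_trans (IH (leqW ld))).
  by have /andP[/ltW] := unfolded_angle_step w n0 ld; rewrite subr_ge0.
by move=> li; rewrite (mono 0%N i) // (mono i n.+1).
Qed.

(** ** The path obtained by folding back a chord *)

Section BelowPi.
Variables (n : nat) (w : bool).
Hypothesis n_gt0 : (0 < n)%N.
Hypothesis swept_angle_lt_pi : swept_angle n w < pi.
Local Notation p := (polar r psi).
Local Notation al := (unfolded_angle n w).
Local Notation D := (swept_angle n w).

Lemma cos_unfolded_gt0 i : (i <= n.+1)%N -> 0 < cos (al i - D / 2).
Proof.
move=> /(unfolded_angle_bounds w n_gt0)/andP[a0 aD]; have := swept_angle_lt_pi => Dpi.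
by rewrite cos_gt0_pihalf //; apply/andP; split; lra.
Qed.

Lemma cos_half_swept_angle_gt0 : 0 < cos (D / 2).
Proof. by have := @cos_unfolded_gt0 0%N isT; rewrite sub0r cosN. Qed.

Lemma radius_gt0 i : (i <= n.+1)%N -> 0 < radius n w i.
Proof.
by move=> li; rewrite divr_gt0 ?mulr_gt0 ?cos_half_swept_angle_gt0 ?cos_unfolded_gt0.
Qed.

Lemma radius_ends : radius n w 0 = r /\ radius n w n.+1 = r.
Proof.
have c0 : cos (D / 2) != 0 by rewrite gt_eqF // cos_half_swept_angle_gt0.
by split; rewrite /radius ?sub0r ?cosN ?mulfK // (_ : D - D / 2 = D / 2) ?mulfK //; field.
Qed.

Lemma vertex_bounce_points i : (i <= n.+1)%N ->
  vertex p (bounce_points n w) i = polar (radius n w i) (path_angle n w i).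
Proof.
have [R0 Rn] := radius_ends; case: i => [_|i]; first by rewrite R0.
rewrite ltnS leq_eqVlt vertexE => /predU1P[->|lin].
  by rewrite nth_default ?size_tuple //= eqxx Rn.
by rewrite -[i]/(nat_of_ord (Ordinal lin)) -tnth_nth tnth_mktuple.
Qed.

Lemma bounce_points_closed : closed_bounce_path gamma p (bounce_points n w).
Proof.
have pi0 := @pi_gt0 R; have /andP[g0 g2] := gamma_acute.
have /andP[psi1 psi2] := psi_inside.
split=> i lin.
- rewrite !vertex_bounce_points ?(ltnW lin) //.
  apply: polar_neq; rewrite ?radius_gt0 // 1?ltnW //.
  rewrite path_angle_step // addrC addKr.
  have /andP[s0 s1] := unfolded_angle_step w n_gt0 lin.
  have : 0 < sin (al i.+1 - al i) by rewrite sin_gt0_pi //; apply/andP; split; lra.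
  by case: (_ (+) _); rewrite /side ?mul1r ?mulN1r ?sinN ?oppr_eq0; apply: lt0r_neq0.
- have in_wedge k : (k <= n.+1)%N -> wedge gamma (vertex p (bounce_points n w) k).
    move=> lk; rewrite vertex_bounce_points //; exists (radius n w k), (path_angle n w k).
    split; rewrite ?radius_gt0 //; case: k {lk} => [|k] /=; first by rewrite !ltW.
    case: eqP => _; first by rewrite !ltW.
    by case: (_ (+) _); rewrite /wall; apply/andP; split; lra.
  by apply: segment_wedge => //; apply: in_wedge; rewrite // ltnW.
- apply/bounceP; exists (w (+) odd i).
  have [l0 l1] : (i <= n.+1 /\ i.+1 <= n.+1)%N by split; lia.
  rewrite !vertex_bounce_points //.
  apply/(bounce_relation w lin radius_gt0).
  set h := r * cos (D / 2).
  have inv k : (radius n w k)^-1 = cos (D / 2) / h * cos (al k) + sin (D / 2) / h * sin (al k).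
    by rewrite /radius invf_div cosB; ring.
  by rewrite !inv; exact: sinusoid_three_points.
Qed.

(** The unfolded path is the chord of a circle of radius [r]. With [h] the
    distance from the origin to the chord, the abscissa along the chord of the
    point at angle [a] from the bisector is [h * tan a], so the lengths of the
    steps telescope. *)
Lemma path_length_bounce_points :
  path_length p (bounce_points n w) = 2 * r * sin (D / 2).
Proof.
have pi0 := @pi_gt0 R.
pose h := r * cos (D / 2).
have h0 : 0 < h by rewrite mulr_gt0 // cos_half_swept_angle_gt0.
pose f i := h * (sin (al i - D / 2) / cos (al i - D / 2)).
have chord i : (i < n.+1)%N ->
    dist (vertex p (bounce_points n w) i) (vertex p (bounce_points n w) i.+1)
    = f i.+1 - f i.
  move=> li; have li' := ltnW li; rewrite !vertex_bounce_points //.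
  have /andP[s0 s1] := unfolded_angle_step w n_gt0 li.
  have c0 := cos_unfolded_gt0 li'; have c1 := cos_unfolded_gt0 li.
  have split_step : al i.+1 - al i = (al i.+1 - D / 2) - (al i - D / 2) by ring.
  have -> : f i.+1 - f i = h * sin (al i.+1 - al i)
      / (cos (al i.+1 - D / 2) * cos (al i - D / 2)).
    rewrite split_step /f; set x := al i.+1 - D / 2; set y := al i - D / 2.
    by rewrite sinB; field; rewrite !lt0r_neq0.
  apply/eqP; rewrite -(@eqrXn2 _ 2) ?dist_ge0 //; last first.
    have s_gt0 : 0 < sin (al i.+1 - al i).
      by rewrite sin_gt0_pi //; apply/andP; split; lra.
    by apply/ltW/divr_gt0; apply: mulr_gt0.
  rewrite dist_polar.
  have -> : cos (path_angle n w i - path_angle n w i.+1) = cos (al i.+1 - al i).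
    rewrite path_angle_step // addrAC addrN add0r.
    by case: (_ (+) _); rewrite /side ?mul1r // mulN1r cosN.
  rewrite split_step /radius -/h.
  set x := al i.+1 - D / 2; set y := al i - D / 2.
  have hx := cos2Dsin2 x; have hy := cos2Dsin2 y.
  apply/eqP; rewrite cosB sinB.
  transitivity (h ^+ 2 * ((cos x ^+ 2 * (cos y ^+ 2 + sin y ^+ 2)
      + cos y ^+ 2 * (cos x ^+ 2 + sin x ^+ 2)
      - 2 * cos x * cos y * (cos x * cos y + sin x * sin y))
      / (cos x * cos y) ^+ 2)); last by field; rewrite !lt0r_neq0.
  by rewrite hx hy; field; rewrite !lt0r_neq0.
rewrite /path_length (eq_bigr (fun i : 'I_n.+1 => f i.+1 - f i)) => [|i _]; last exact: chord.
rewrite -(big_mkord xpredT (fun i => f i.+1 - f i)) telescope_sumr // /f.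
rewrite -/D sub0r sinN cosN (_ : D - D / 2 = D / 2) ?mulNr ?mulrN ?opprK; last by field.
by rewrite /h; field; rewrite lt0r_neq0 // cos_half_swept_angle_gt0.
Qed.

End BelowPi.

(** A closed path is determined by its first wall: the walls then alternate,
    which fixes all the unfolded angles, and the distances to the vertex are
    those of the chord between the base point and its last image. *)
Lemma closed_bounce_pathP n (q : n.-tuple (R * R)) : (0 < n)%N ->
  closed_bounce_path gamma (polar r psi) q <->
  exists2 w, swept_angle n w < pi & q = bounce_points n w.
Proof.
move=> n0; split; last by case=> w Dpi ->; exact: bounce_points_closed.
case=> _ _ bq; set p := polar r psi in bq *; set v := vertex p q in bq *.
have [w hw] : exists w, forall i, (i < n)%N ->
    reflected_off (wall (w (+) odd i)) (v i) (v i.+1) (v i.+2).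
  have /bounceP[w hw] := bq _ n0; exists w; elim=> [|i IH] lin.
    by rewrite addbF.
  have /bounceP[w' hw'] := bq _ lin.
  suff -> : w (+) odd i.+1 = w' by [].
  have [hray _ _ _] := hw'.
  have := reflected_off_notin (IH (ltnW lin)).
  rewrite /= addbN; case: (w (+) odd i) w' hray {hw'} => -[] //=.
pose rho i := Num.sqrt ((v i).1 ^+ 2 + (v i).2 ^+ 2).
have v0 : v 0%N = p by [].
have vn : v n.+1 = p by rewrite /v vertexE nth_default // size_tuple.
have rhop : Num.sqrt (p.1 ^+ 2 + p.2 ^+ 2) = r by rewrite polar_norm // ltW.
have rho_0 : rho 0%N = r by rewrite /rho v0.
have rho_n : rho n.+1 = r by rewrite /rho vn.
have vE k : (k <= n.+1)%N -> 0 < rho k /\ v k = polar (rho k) (path_angle n w k).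
  case: k => [_|k]; first by rewrite rho_0.
  rewrite ltnS leq_eqVlt => /predU1P[->|lk]; first by rewrite rho_n vn /= eqxx.
  have [[s s0 vs] _ _ _] := hw _ lk.
  by rewrite /rho vs polar_norm ?(ltW s0) //= (ltn_eqF lk).
have rho_gt0 k : (k <= n.+1)%N -> 0 < rho k by move=> /vE[].
have rel i : (i < n)%N -> (rho i.+1)^-1 * sin (unfolded_angle n w i.+2 - unfolded_angle n w i) =
    (rho i)^-1 * sin (unfolded_angle n w i.+2 - unfolded_angle n w i.+1)
    + (rho i.+2)^-1 * sin (unfolded_angle n w i.+1 - unfolded_angle n w i).
  move=> lin; apply/(bounce_relation w lin rho_gt0).
  have [l0 l1] : (i <= n.+1 /\ i.+1 <= n.+1)%N by split; lia.
  by have := hw _ lin; rewrite (vE _ l0).2 (vE _ l1).2 (vE i.+2 lin).2.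
have step i : (i <= n)%N -> 0 < unfolded_angle n w i.+1 - unfolded_angle n w i < pi / 2.
  exact: unfolded_angle_step.
have inv_gt0 i : (i <= n.+1)%N -> 0 < (rho i)^-1.
  by move=> li; rewrite invr_gt0 rho_gt0.
have [] := discrete_sinusoid_chord step inv_gt0 rel.
rewrite /= -/(unfolded_angle n w n.+1) -/(swept_angle n w) subr0 => /andP[D0 Dpi] chord.
exists w => //; apply: eq_from_tnth => i.
have li : (i.+1 <= n.+1)%N by rewrite ltnS ltnW.
have := vE _ li; rewrite tnth_mktuple (tnth_nth p) -vertexE -/v => -[_ ->].
congr polar; apply: invr_inj.
have S0 : sin (swept_angle n w / 2) != 0.
  by rewrite lt0r_neq0 // sin_gt0_pi //; apply/andP; split; lra.
have C0 : cos (swept_angle n w / 2) != 0.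
  by rewrite lt0r_neq0 // cos_half_swept_angle_gt0.
have c0 : cos (unfolded_angle n w i.+1 - swept_angle n w / 2) != 0.
  by rewrite lt0r_neq0 // cos_unfolded_gt0.
have r0 : r != 0 by rewrite lt0r_neq0.
have SC : 2 * sin (swept_angle n w / 2) * cos (swept_angle n w / 2) != 0.
  by rewrite !mulf_neq0 ?pnatr_eq0.
apply: (mulIf SC); rewrite -[LHS](_ : (rho i.+1)^-1 * sin (swept_angle n w) = _).
  rewrite [LHS](chord _ li) rho_0 rho_n -mulrDr subr0.
  have := sinD_half_sum 0 (unfolded_angle n w i.+1) (swept_angle n w); rewrite /= !subr0 => ->.
  by rewrite /radius; field; rewrite r0 C0 c0.
rewrite -[in LHS](_ : swept_angle n w / 2 + swept_angle n w / 2 = swept_angle n w); last by field.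
by rewrite sinD; ring.
Qed.

End Unfolding.

(** * Counting closed paths *)

Section ClosedPathsBetweenTwoWalls.
Context {R : realType}.
Variables gamma psi r : R.
Implicit Types (w : bool) (m n : nat).

Lemma offsetD w : offset gamma psi w + offset gamma psi (~~ w) = gamma.
Proof. by case: w; rewrite /offset /side /wall /=; ring. Qed.

(** For an even number of bounces, the first and last walls differ and the two
    offsets of the base point add up to [gamma]. *)
Lemma swept_angle_even m w : (0 < m)%N ->
  swept_angle gamma psi (2 * m) w = (2 * m)%:R * gamma.
Proof.
move=> m_gt0; rewrite /swept_angle /= eqxx -[in RHS](prednK (n := 2 * m)) ?muln_gt0 //.
have -> : odd (2 * m).-1 by lia.
by rewrite addbT -natr1 mulrDl mul1r addrCA offsetD.
Qed.

(** For an odd number of bounces, the first and last walls coincide. *)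
Lemma swept_angle_odd m w :
  swept_angle gamma psi (2 * m + 1) w = 2 * (m%:R * gamma + offset gamma psi w).
Proof.
rewrite /swept_angle /= eqxx addn1 /= mul2n odd_double addbF -mul2n natrM; ring.
Qed.

(** Reversing a path replaces its first wall by its last one, here the opposite
    wall, and mirrors the unfolded angles in the bisector of the chord. *)
Lemma rev_bounce_points m w : (0 < m)%N ->
  [tuple of rev (bounce_points gamma psi r (2 * m) w)] =
  bounce_points gamma psi r (2 * m) (~~ w).
Proof.
move=> m_gt0; apply: eq_from_tnth => i; have lim := ltn_ord i.
have ljm : (2 * m - i.+1 < 2 * m)%N by lia.
rewrite [RHS]tnth_mktuple (tnth_nth (polar r psi)) nth_rev ?size_tuple //.
rewrite -[(2 * m - i.+1)%N]/(nat_of_ord (Ordinal ljm)) -tnth_nth tnth_mktuple.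
rewrite /radius !swept_angle_even // /path_angle /unfolded_angle (ltn_eqF ljm) (ltn_eqF lim).
congr polar; last first.
  congr wall; have -> : odd (2 * m - i.+1) = ~~ odd i by lia.
  by rewrite addbN addNb.
congr (_ / _); rewrite -[RHS]cosN; congr cos.
rewrite natrB // [offset _ _ w](_ : _ = gamma - offset gamma psi (~~ w)); last first.
  by rewrite -{2}(offsetD w) addrK.
by rewrite -[i.+1]addn1 natrD; field.
Qed.

(** The first bounces are off different walls. *)
Lemma bounce_points_neq n : 0 < gamma < pi / 2 ->
  pi / 2 - gamma < psi < pi / 2 -> 0 < r -> (0 < n)%N ->
  swept_angle gamma psi n true < pi -> swept_angle gamma psi n false < pi ->
  bounce_points gamma psi r n true != bounce_points gamma psi r n false.
Proof.
move=> gamma_acute psi_inside r_gt0 n0 o1 o2.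
have pi0 := @pi_gt0 R; have /andP[g0 g2] := gamma_acute.
have g1 : gamma < pi by lra.
apply/eqP => /(congr1 (fun t => tnth t (Ordinal n0))); apply/eqP.
rewrite !tnth_mktuple /= ltn_eqF // polar_neq ?radius_gt0 //.
rewrite /wall /= (_ : _ - _ = - gamma); last by ring.
by rewrite sinN oppr_eq0 lt0r_neq0 // sin_gt0_pi // g0.
Qed.

End ClosedPathsBetweenTwoWalls.

Lemma card_set2 (T : Type) (a b : T) : a <> b -> [set a; b] #= `I_2.
Proof.
move=> ab; apply/eq_cardSP; exists b; first by right.
rewrite (_ : _ `\ b = [set a]) ?card_set1 // eqEsubset; split=> x /=.
  by case=> -[].
by move=> ->; split=> //; left.
Qed.

Theorem theorem1 (R : realType) (gamma : R) (m : nat) (r psi : R)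
  (hgamma : 0 < gamma < pi / 2) (hm : (1 <= m)%N) (hr : 0 < r)
  (hpsi : pi / 2 - gamma < psi < pi / 2) :
  let p := polar r psi in
  let evenpaths := [set q : (2 * m).-tuple (R * R) |
                      closed_bounce_path gamma p q] in
  let oddpaths := [set q : (2 * m + 1).-tuple (R * R) |
                     closed_bounce_path gamma p q] in
  let A := psi < pi - (m + 1)%:R * gamma in
  let B := m%:R * gamma < psi in
  [/\ (exists q, evenpaths q) <-> gamma < pi / (2 * m)%:R,
      evenpaths #<= `I_2,
      forall q, evenpaths q -> evenpaths = [set q; [tuple of rev q]]
    & forall q, evenpaths q ->
        path_length p q = 2 * r * `|sin (m%:R * gamma)|]
  /\
  [/\ (exists q, oddpaths q) <-> gamma < pi / (2 * m)%:R /\ (A \/ B),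
      oddpaths #= `I_(A + B)%N
    & exists qA qB : (2 * m + 1).-tuple (R * R),
        [/\ forall q, oddpaths q <-> (A /\ q = qA) \/ (B /\ q = qB),
            A -> path_length p qA =
                   2 * r * `|cos (psi + (m + 1)%:R * gamma)|
          & B -> path_length p qB = 2 * r * `|cos (psi - m%:R * gamma)|]].
Proof.
move=> p evenpaths oddpaths A B.
have pi0 := @pi_gt0 R.
have /andP[g0 g2] := hgamma; have /andP[psi1 psi2] := hpsi.
have m2 : (0 < 2 * m)%N by rewrite muln_gt0.
have mg0 : 0 < m%:R * gamma by rewrite mulr_gt0 // ltr0n.
have thr : (gamma < pi / (2 * m)%:R) = (2 * (m%:R * gamma) < pi).
  by rewrite ltr_pdivlMr ?ltr0n // mulrC natrM mulrA.
split.
  pose c w := bounce_points gamma psi r (2 * m) w.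
  have op w : swept_angle gamma psi (2 * m) w = 2 * (m%:R * gamma).
    by rewrite swept_angle_even // natrM mulrA.
  have evenP q : evenpaths q <-> gamma < pi / (2 * m)%:R /\ exists w, q = c w.
    rewrite /evenpaths /= closed_bounce_pathP //.
    by split=> [[w] | [h [w]]]; rewrite ?op -?thr => *; [split | ]; try exists w;
      rewrite ?op -?thr.
  have evenE : gamma < pi / (2 * m)%:R -> evenpaths = [set c true; c false].
    move=> h; apply/seteqP; split=> q /=.
      by case/evenP=> _ [[] ->]; [left | right].
    by case=> ->; apply/evenP; split=> //; [exists true | exists false].
  split.
  - split; first by case=> q /evenP[].
    by move=> h; exists (c true); rewrite evenE //; left.
  - have [h|h] := boolP (gamma < pi / (2 * m)%:R).
      rewrite evenE //; have neq : c true <> c false.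
        by apply/eqP/bounce_points_neq; rewrite // op -thr.
      by have /card_eqPle[] := card_set2 neq.
    rewrite (_ : evenpaths = set0) ?card_le0x //.
    by rewrite -subset0 => q /evenP[]; rewrite (negPf h).
  - move=> q /evenP[h [w ->]]; rewrite evenE // rev_bounce_points //.
    by case: w => //; rewrite setUC.
  - move=> q /evenP[h [w ->]].
    have ow : swept_angle gamma psi (2 * m) w < pi by rewrite op -thr.
    rewrite path_length_bounce_points // op (mulrC 2 (_ * gamma)) mulfK ?pnatr_eq0 //.
    rewrite ger0_norm // sin_ge0_pi //; rewrite thr in h.
    by apply/andP; split; lra.
pose c w := bounce_points gamma psi r (2 * m + 1) w.
have m21 : (0 < 2 * m + 1)%N by rewrite addn1.
have op w := swept_angle_odd gamma psi m w.
have AE : A = (swept_angle gamma psi (2 * m + 1) true < pi).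
  by rewrite /A op /offset /side /wall natrD; apply/idP/idP; lra.
have BE : B = (swept_angle gamma psi (2 * m + 1) false < pi).
  by rewrite /B op /offset /side /wall; apply/idP/idP; lra.
have oddP q : oddpaths q <-> (A /\ q = c true) \/ (B /\ q = c false).
  rewrite /oddpaths /= closed_bounce_pathP // AE BE.
  split; first by case=> -[] h ->; [left | right].
  by case=> -[h ->]; [exists true | exists false].
have A_lt : A -> gamma < pi / (2 * m)%:R.
  by rewrite thr /A natrD => h; lra.
have B_lt : B -> gamma < pi / (2 * m)%:R.
  by rewrite thr /B => h; lra.
split.
- split.
    by case=> q /oddP[[h _]|[h _]]; [split; [exact: A_lt | left] | split; [exact: B_lt | right]].
  by case=> _ [h|h]; [exists (c true) | exists (c false)]; apply/oddP; auto.
- have oddE a b : A = a -> B = b ->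
      oddpaths = (if a then [set c true] else set0) `|` (if b then [set c false] else set0).
    move=> <- <-; apply/seteqP; split=> q.
      by case/oddP=> -[-> ->]; [left | right].
    by case; case: ifP => // h -> ; apply/oddP; auto.
  case EA : A; case EB : B; rewrite (oddE _ _ EA EB) ?setU0 ?set0U /=.
  + apply: card_set2; apply/eqP; apply: bounce_points_neq => //.
    * by rewrite -AE.
    * by rewrite -BE.
  + exact: card_set1.
  + exact: card_set1.
  + by rewrite II0.
exists (c true), (c false); split=> // h.
- rewrite path_length_bounce_points -?AE //; congr (_ * _).
  have -> : swept_angle gamma psi (2 * m + 1) true / 2 = psi + (m + 1)%:R * gamma - pi / 2.
    by rewrite op /offset /side /wall natrD; field.
  rewrite sinBpihalf ler0_norm // -oppr_ge0 -sinBpihalf sin_ge0_pi //.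
  by move: h; rewrite /A natrD => h; apply/andP; split; lra.
- rewrite path_length_bounce_points -?BE //; congr (_ * _).
  have -> : swept_angle gamma psi (2 * m + 1) false / 2 = - (psi - m%:R * gamma - pi / 2).
    by rewrite op /offset /side /wall; field.
  rewrite sinN sinBpihalf opprK ger0_norm // cos_ge0_pihalf //.
  by move: h; rewrite /B => h; apply/andP; split; lra.
Qed.
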